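(* For every $n\in\mathbb{N}=\{1,2,3,\dots\}$, the set $\mathcal{ND}[0,1]$ of continuous nowhere differentiable functions is $(n,\aleph_0)$-lineable as a subset of the real vector space $C[0,1]$. Explicitly, for every $n\in\mathbb{N}$: there exists an $n$-dimensional vector subspace $W\subset C[0,1]$ with $W\setminus\{0\}\subset\mathcal{ND}[0,1]$, and for every $n$-dimensional vector subspace $F\subset C[0,1]$ with $F\setminus\{0\}\subset\mathcal{ND}[0,1]$ there exists a vector subspace $G\subset C[0,1]$ of (algebraic) dimension $\aleph_0$ such that $F\subset G$ and $G\setminus\{0\}\subset\mathcal{ND}[0,1]$.
   Context: $C[0,1]$ is the real vector space of continuous functions $f:[0,1]\to\mathbb{R}$. A function $f\in C[0,1]$ is differentiable at $x\in[0,1]$ if $\frac{f(x+t)-f(x)}{t}$ has a limit in $\mathbb{R}$ as $t\to0$ over nonzero $t$ with $x+t\in[0,1]$ (so at the endpoints $0$ and $1$ differentiability is understood in the one-sided sense). $\mathcal{ND}[0,1]:=\{f\in C[0,1]: f \text{ is nowhere differentiable}\}$, that is, the set of $f\in C[0,1]$ that are not differentiable at any point $x\in[0,1]$. Let $V$ be a vector space and $A\subset V$. For a cardinal $\alpha$, $A$ is $\alpha$-lineable if there is an $\alpha$-dimensional subspace $W\subset V$ with $W\setminus\{0\}\subset A$. For cardinals $\alpha<\beta$, $A$ is $(\alpha,\beta)$-lineable if $A$ is $\alpha$-lineable and every $\alpha$-dimensional subspace $F\subset V$ with $F\setminus\{0\}\subset A$ can be extended to a $\beta$-dimensional subspace $G\subset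 V$ with $F\subset G$ and $G\setminus\{0\}\subset A$. *)

(* Defs.v *)
From HB Require Import structures.
From mathcomp Require Import all_boot all_order all_algebra.
From mathcomp Require Import all_classical all_reals all_analysis.

Set Implicit Arguments.
Unset Strict Implicit.
Unset Printing Implicit Defensive.

Import Order.TTheory GRing.Theory Num.Theory.
Import numFieldNormedType.Exports.

Local Open Scope classical_set_scope.
Local Open Scope card_scope.
Local Open Scope ring_scope.

Section lineability.
Context {R : fieldType} {V : lmodType R}.
Implicit Types (A B W : set V).

Definition lin_span B : set V :=
  [set v | exists (s : seq V) (a : V -> R),
     [set` s] `<=` B /\ v = \sum_(u <- s) a u *: u].

Definition lin_indep B : Prop :=
  forall (s : seq V) (a : V -> R), uniq s -> [set` s] `<=` B ->
    \sum_(u <- s) a u *: u = 0 -> forall u, u \in s -> a u = 0.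

(* A cardinal is represented by any set K having that cardinality: `I_n for   *)
(* the natural number n, [set: nat] for aleph_0. The dimension is algebraic.  *)
Definition subspace_of_dim {T : Type} (K : set T) W : Prop :=
  GRing.submod_closed [in W] /\
  exists B, [/\ lin_indep B, lin_span B = W & B #= K].

Definition lineable {T : Type} (K : set T) A : Prop :=
  exists2 W, subspace_of_dim K W & W `\` [set 0] `<=` A.

(* Meant for cardinals K < L. *)
Definition pair_lineable {T U : Type} (K : set T) (L : set U) A : Prop :=
  lineable K A /\
  forall F, subspace_of_dim K F -> F `\` [set 0] `<=` A ->
    exists G, [/\ subspace_of_dim L G, F `<=` G & G `\` [set 0] `<=` A].

End lineability.

Section continuous_lmodule.
Context {X : topologicalType} {R : realType}.
Implicit Types f g h : continuousType X R.

Lemma zero_cts : continuous (cst 0 : X -> R).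
Proof. exact: cst_continuous. Qed.

Lemma opp_cts f : continuous (fun x : X => - f x).
Proof. by move=> x; apply: cvgN; exact: cts_fun. Qed.

Lemma add_cts f g : continuous (fun x : X => f x + g x).
Proof. by move=> x; apply: cvgD; exact: cts_fun. Qed.

Lemma scale_cts (c : R) f : continuous (fun x : X => c * f x).
Proof. by move=> x; apply: cvgM; [exact: cvg_cst | exact: cts_fun]. Qed.

Definition cts_zero : continuousType X R := mkcts zero_cts.
Definition cts_opp f : continuousType X R := mkcts (@opp_cts f).
Definition cts_add f g : continuousType X R := mkcts (@add_cts f g).
Definition cts_scale (c : R) f : continuousType X R := mkcts (@scale_cts c f).

Lemma cts_addA : associative cts_add.
Proof. by move=> f g h; apply/continuousEP => x; exact: addrA. Qed.

Lemma cts_addC : commutative cts_add.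
Proof. by move=> f g; apply/continuousEP => x; exact: addrC. Qed.

Lemma cts_add0 : left_id cts_zero cts_add.
Proof. by move=> f; apply/continuousEP => x; exact: add0r. Qed.

Lemma cts_addN : left_inverse cts_zero cts_opp cts_add.
Proof. by move=> f; apply/continuousEP => x; exact: addNr. Qed.

HB.instance Definition _ :=
  GRing.isZmodule.Build (continuousType X R) cts_addA cts_addC cts_add0 cts_addN.

Lemma cts_scaleA c d f : cts_scale c (cts_scale d f) = cts_scale (c * d) f.
Proof. by apply/continuousEP => x; exact: mulrA. Qed.

Lemma cts_scale1 : left_id 1 cts_scale.
Proof. by move=> f; apply/continuousEP => x; exact: mul1r. Qed.

Lemma cts_scaleDr : right_distributive cts_scale +%R.
Proof. by move=> c f g; apply/continuousEP => x; exact: mulrDr. Qed.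

Lemma cts_scaleDl f : {morph cts_scale^~ f : c d / c + d}.
Proof. by move=> c d; apply/continuousEP => x; exact: mulrDl. Qed.

HB.instance Definition _ := GRing.Zmodule_isLmodule.Build R (continuousType X R)
  cts_scaleA cts_scale1 cts_scaleDr cts_scaleDl.

End continuous_lmodule.

(* The topology on this subtype is the one induced by R. *)
Definition I01 (R : realType) : topologicalType := set_type `[0%R : R, 1%R].

Definition C01 (R : realType) : lmodType R := continuousType (I01 R) R.

Section differentiability.
Variable R : realType.
Implicit Types f : continuousType (I01 R) R.

(* insubd x y is y as a point of [0, 1] when y lies in [0, 1] (the default    *)
(* value x is never used here, t being restricted to \val x + t in [0, 1]).   *)
Definition C01_differentiable_at f (x : I01 R) : Prop :=
  exists l : R,
    (f (insubd x (\val x + t)) - f x) / t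
      @[t --> within [set t | `[0, 1]%classic (\val x + t)] 0^'] --> l.

Definition ND01 : set (C01 R) :=
  [set f | forall x : I01 R, ~ C01_differentiable_at f x].

End differentiability.

Arguments ND01 R : clear implicits.

(* Main.v *)
Require Import Defs.
From mathcomp Require Import all_boot all_order all_algebra.
From mathcomp Require Import finmap lra.
From mathcomp Require Import all_classical all_reals all_analysis.

(** The key fact is that adding one more direction never fails: for every finite
    list [L] of continuous functions there is a continuous [g] such that [g + f]
    is nowhere differentiable for every [f] in the span of [L]
    (Lemma [wild_direction]).  The functions of [L] have a common modulus of
    continuity [w], and any [f] in their span has modulus [C * w] for some
    constant [C]; so it is enough that [g] oscillates near every point
    by much more than both [w] and a linear function along some sequence of
    scales tending to 0.  A Weierstrass-type sum
    [g = \sum_k 8^-k cos (N_k pi x)] does this when the frequency [N_k]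
    is chosen, after the terms of lower index, so large that [1/N_k] is small
    compared with [8^-k], and that at distance [1/N_k] the partial sum over lower
    indices and the functions of [L] are nearly constant compared with [8^-k].  The wave of index [k] then dominates there:
    the waves of higher index are too small altogether, and the others vary too
    little.

    The rest is linear algebra, valid for any set [A] in a vector space that is
    stable under nonzero scaling, does not contain 0 and satisfies this
    one-direction property (Lemma [pair_lineable_of_extension]).  If a space [F]
    satisfies [F \ 0 <= A], then so does [F + <g>]: its elements lie in [F] or
    have the form [c (g + f)] with [c != 0] and [f] in [F].  Moreover [g] is not
    in [F], for otherwise [0 = g - g] would be in [A].  Iterating from the zero
    space yields all finite dimensions; iterating from a basis of a
    given finite-dimensional [F] and taking the union yields a space of dimension
    [aleph_0] containing [F]. *)

Set Implicit Arguments.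
Unset Strict Implicit.
Unset Printing Implicit Defensive.

Import Order.TTheory GRing.Theory Num.Theory.
Import numFieldNormedType.Exports.

Local Open Scope classical_set_scope.
Local Open Scope card_scope.
Local Open Scope ring_scope.

(** * Spans and bases *)

Section linear_span.
Context {R : fieldType} {V : lmodType R}.
Implicit Types (A B W : set V) (s t L : seq V).

(** The list in [lin_span] may repeat vectors; repetitions are absorbed in the
    coefficients so that combinations can be added termwise. *)
Lemma lin_span_uniqP B v : lin_span B v <->
  exists s (a : V -> R), [/\ uniq s, [set` s] `<=` B & v = \sum_(u <- s) a u *: u].
Proof.
split=> [[s [a [sB ->]]]|[s [a [_ sB ->]]]]; last by exists s, a.
exists (undup s), (fun u => a u *+ count_mem u s); split.
- exact: undup_uniq.
- by move=> u; rewrite /= mem_undup; exact: sB.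
- rewrite -big_undup_iterop_count; apply: eq_bigr => u _.
  by rewrite -scalerMnl Monoid.iteropE iter_addr_0.
Qed.

Lemma sum_sub_uniq s t (F : V -> V) : uniq s -> uniq t -> {subset s <= t} ->
  \sum_(u <- s) F u = \sum_(u <- t) (if u \in s then F u else 0).
Proof.
move=> us ut st; rewrite -big_mkcond -big_filter.
apply: perm_big; apply: uniq_perm => //; first exact: filter_uniq.
by move=> u; rewrite mem_filter; case: (boolP (u \in s)) => // /st ->.
Qed.

Lemma lin_span_submod B : GRing.submod_closed [in lin_span B].
Proof.
split=> [|c u v]; rewrite !inE.
  by exists [::], (fun=> 0); rewrite big_nil; split => // x.
move=> /lin_span_uniqP[s [a [us sB ->]]] /lin_span_uniqP[t [b [ut tB ->]]].
exists (undup (s ++ t)), (fun u => (if u \in s then c * a u else 0) +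
  (if u \in t then b u else 0)); split.
  by move=> x; rewrite /= mem_undup mem_cat => /orP[/sB|/tB].
have uu := undup_uniq (s ++ t).
rewrite scaler_sumr (sum_sub_uniq _ us uu); last first.
  by move=> x xs; rewrite mem_undup mem_cat xs.
rewrite (sum_sub_uniq _ ut uu); last first.
  by move=> x xs; rewrite mem_undup mem_cat xs orbT.
rewrite -big_split; apply: eq_bigr => x _ /=; rewrite scalerDl.
by congr (_ + _); case: ifP; rewrite ?scale0r ?scalerA.
Qed.

Lemma lin_span0 B : lin_span B 0.
Proof. by have [+ _] := lin_span_submod B; rewrite inE. Qed.

Lemma lin_spanD B (c : R) u v :
  lin_span B u -> lin_span B v -> lin_span B (c *: u + v).
Proof.
by have [_ /(_ c u v)] := lin_span_submod B; rewrite !inE; exact.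
Qed.

Lemma lin_spanZ B (c : R) u : lin_span B u -> lin_span B (c *: u).
Proof. by move=> Bu; rewrite -[_ *: _]addr0; apply/lin_spanD/lin_span0. Qed.

Lemma lin_span_cons g L v : lin_span [set` g :: L] v ->
  exists c f, lin_span [set` L] f /\ v = c *: g + f.
Proof.
move=> [s [a [sL ->]]]; elim: s sL => [|u s IHs] sL.
  by exists 0, 0; rewrite big_nil scale0r addr0; split => //; exact: lin_span0.
have [|c [f [Lf fE]]] := IHs.
  by move=> x xs; apply: sL; rewrite /= inE xs orbT.
rewrite big_cons fE; have := sL u (mem_head _ _).
rewrite /= inE => /orP[/eqP->|uL].
  by exists (a g + c), f; split => //; rewrite scalerDl addrA.
exists c, (a u *: u + f); split; last by rewrite addrCA.
apply: lin_spanD => //; exists [:: u], (fun=> 1).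
by rewrite big_seq1 scale1r; split => // x; rewrite /= inE => /eqP->.
Qed.

(** In a vanishing combination the coefficient of [g] must be 0, since otherwise
    dividing by it would express [g] in terms of [L]. *)
Lemma lin_indep_cons g L : ~ lin_span [set` L] g -> lin_indep [set` L] ->
  lin_indep [set` g :: L].
Proof.
move=> gL iL s a us sL s0.
have key t : uniq t -> [set` t] `<=` [set` L] ->
    \sum_(u <- t) a u *: u = 0 -> forall u, u \in t -> a u = 0 by exact: iL.
have sub t : {subset t <= s} -> g \notin t -> [set` t] `<=` [set` L].
  move=> ts gt u ut; have := sL u (ts _ ut); rewrite /= inE => /orP[/eqP ug|//].
  by rewrite -ug ut in gt.
have [gs|gs] := boolP (g \in s); last by apply: key => //; exact: sub.
have rE := perm_to_rem gs; rewrite (perm_big _ rE) big_cons /= in s0.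
have /= /andP[gr ur] : uniq (g :: rem g s) by rewrite -(perm_uniq rE).
have rL : [set` rem g s] `<=` [set` L] by apply: sub => // u /mem_rem.
have ag : a g = 0.
  have [//|ag] := eqVneq (a g) 0; case: gL.
  have -> : g = - (a g)^-1 *: \sum_(u <- rem g s) a u *: u.
    apply: (@scalerI _ _ (a g)) => //; rewrite scalerA mulrN divff// scaleN1r.
    by apply/eqP; rewrite -addr_eq0 s0.
  by apply: lin_spanZ; exists (rem g s), a.
move: s0; rewrite ag scale0r add0r => s0 u; rewrite (perm_mem rE) inE.
by move=> /orP[/eqP->//|]; exact: key.
Qed.

End linear_span.

(** * Lineability by adding one direction at a time *)

Section extension.
Context {R : fieldType} {V : lmodType R} (A : set V).
Implicit Types (L : seq V).

(** The invariant of the iteration. *)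
Definition free_in L := [/\ uniq L, lin_indep [set` L] &
  lin_span [set` L] `\` [set 0] `<=` A].

Lemma free_in_nil : free_in [::].
Proof.
split=> //; first by move=> [|u s] a _ => [_ _ u //|/(_ u (mem_head _ _))].
move=> v [[[|u s] [a [+ ->]]]]; first by rewrite big_nil => _ [].
by move=> /(_ u (mem_head _ _)).
Qed.

Hypothesis A0 : ~ A 0.
Hypothesis AZ : forall c f, c != 0 -> A f -> A (c *: f).

(** A vector of the larger span is in the old span or is [c (g + f)] with
    [c != 0]; and [g] is new because [g - g = 0] is not in [A]. *)
Lemma free_in_cons L g :
  free_in L -> (forall f, lin_span [set` L] f -> A (g + f)) -> free_in (g :: L).
Proof.
move=> [uL iL LA] gA.
have gL : ~ lin_span [set` L] g.
  move=> Lg; apply: A0; rewrite -(subrr g); apply: gA.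
  by rewrite -scaleN1r; exact: lin_spanZ.
split.
- rewrite /= uL andbT; apply/negP => gL'; apply: gL; exists [:: g], (fun=> 1).
  by rewrite big_seq1 scale1r; split => // x; rewrite /= inE => /eqP->.
- exact: lin_indep_cons.
- move=> v [/lin_span_cons[c [f [Lf ->]]]].
  have [->|c0] := eqVneq c 0; first by rewrite scale0r add0r => f0; exact: LA.
  move=> _; have -> : c *: g + f = c *: (g + c^-1 *: f).
    by rewrite scalerDr scalerA divff// scale1r.
  by apply: AZ => //; apply: gA; exact: lin_spanZ.
Qed.

Hypothesis one_more :
  forall L, exists g, forall f, lin_span [set` L] f -> A (g + f).

(** The bases form an increasing chain of lists; a finite combination of vectors
    in the union of the chain involves only one of the lists, so freeness and
    membership in [A] pass to the union. *)
Lemma pair_lineable_of_extension n : pair_lineable `I_n [set: nat] A.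
Proof.
have [next nextA] := choice one_more.
pose chain L0 k := iter k (fun L => next L :: L) L0.
have chain_free L0 k : free_in L0 -> free_in (chain L0 k).
  by move=> L0f; elim: k => //= k IHk; apply: free_in_cons => //; exact: nextA.
have chain_size L0 k : size (chain L0 k) = (k + size L0)%N.
  by elim: k => //= k ->.
have card_seq L : uniq L -> [set` L] #= `I_(size L).
  move=> uL; have -> : [set` L] = [set` [fset x in L]%fset].
    by apply/seteqP; split=> x /=; rewrite inE.
  by apply/card_eq_fsetP; rewrite card_fseq undup_id.
split.
  have [u i s] := chain_free [::] n free_in_nil.
  exists (lin_span [set` chain [::] n]) => //.
  split; first exact: lin_span_submod.
  exists [set` chain [::] n]; split => //.
  by have := card_seq _ u; rewrite chain_size addn0.
move=> F [_ [B [iB BF Bn]]] FA.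
have [s sB] : exists s : seq V, B = [set` s] by apply/finite_seqP; exists n.
have L0f : free_in (undup s).
  have sE : [set` undup s] = B.
    by rewrite sB; apply/seteqP; split=> x /=; rewrite mem_undup.
  by split; rewrite ?undup_uniq// sE// BF.
pose L := chain (undup s).
have Lsub j k : (j <= k)%N -> {subset L j <= L k}.
  move=> /subnK <-; elim: (k - j)%N => // m IHm x /IHm xL.
  by rewrite addSn /= inE xL orbT.
pose B' := \bigcup_k [set` L k].
have B'L (t : seq V) : [set` t] `<=` B' -> exists k, [set` t] `<=` [set` L k].
  elim: t => [_|u t IHt uB]; first by exists 0%N => x.
  have [|k tk] := IHt; first by move=> x xt; apply: uB; rewrite /= inE xt orbT.
  have [j _ uj] := uB u (mem_head _ _); exists (maxn j k) => x /=.
  rewrite inE => /orP[/eqP->|/tk]; first exact: (Lsub j _ (leq_maxl _ _)).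
  by apply: Lsub; exact: leq_maxr.
exists (lin_span B'); split.
- split; first exact: lin_span_submod.
  exists B'; split => //.
    move=> t a ut /B'L[k tk]; have [_ iLk _] := chain_free _ k L0f; exact: iLk.
  (* If the union were finite, some list of the chain would contain its
     strictly longer successor. *)
  apply: eq_card_nat.
    by apply: bigcup_countable => // k _; exact/finite_set_countable/finite_seq.
  move=> /finite_seqP[t tE].
  have [k tk] : exists k, [set` t] `<=` [set` L k] by apply: B'L; rewrite -tE.
  have [u1 _ _] := chain_free _ k.+1 L0f.
  have : {subset L k.+1 <= L k}.
    by move=> x xL; apply: tk; rewrite -tE; exists k.+1.
  by move=> /(uniq_leq_size u1); rewrite ltnn.
- rewrite -BF => v [t [a [tB ->]]]; exists t, a; split => // x /tB.
  by rewrite sB /= => xs; exists 0%N => //=; rewrite mem_undup.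
- move=> v [[t [a [/B'L[k tk] ->]]] v0].
  by have [_ _ LA] := chain_free _ k L0f; apply: LA; split => //; exists t, a.
Qed.

End extension.

(** * Continuous functions on the unit interval *)

Section modulus.
Variable R : realType.
Implicit Types (u f g : C01 R) (x y : I01 R) (e d : R) (L : seq (C01 R)).

Lemma C01_itv x : 0 <= \val x <= 1.
Proof. by have := set_valP x; rewrite /= in_itv. Qed.

Lemma C01_addE f g x : (f + g : C01 R) x = f x + g x :> R.
Proof. by []. Qed.

Lemma C01_scaleE (c : R) f x : (c *: f : C01 R) x = c * f x :> R.
Proof. by []. Qed.

Lemma C01_continuous_at u x e : 0 < e -> exists2 d : R, 0 < d &
  forall y, `|\val y - \val x| < d -> `|u y - u x| < e.
Proof.
move=> e0.
have /(_ _ (nbhsx_ballx (u x) e e0)) : u @ x --> u x by exact: cts_fun.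
move=> [_ [[U oU <-] Ux Ue]].
have /nbhs_ballP[d /= d0 dU] : nbhs (\val x) U by apply: open_nbhs_nbhs.
exists d => // y yx; rewrite distrC; apply: Ue; apply: dU.
by rewrite /ball /= distrC.
Qed.

Lemma eps_delta_continuous (h : I01 R -> R) :
  (forall x e, 0 < e -> exists2 d : R, 0 < d &
    forall y, `|\val y - \val x| < d -> `|h y - h x| < e) -> continuous h.
Proof.
move=> H x A /nbhs_ballP[e /= e0 eA]; have [d d0 hd] := H x e e0.
have valx : (fun y : I01 R => \val y) @ x --> \val x.
  exact: (@initial_continuous _ _ set_val).
apply: (@filterS _ _ (nbhs_filter x)) (valx _ (nbhsx_ballx _ d d0)) => y yx.
apply: eA.
by rewrite /ball /= distrC; apply: hd; rewrite distrC.
Qed.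

(** Heine-Cantor for [0, 1], by compactness of the segment in [R] in its
    near-covering form, with [d] tending to 0 as the parameter. *)
Lemma C01_unif_continuous u e : 0 < e -> exists2 d : R, 0 < d &
  forall x y, `|\val y - \val x| < d -> `|u y - u x| < e.
Proof.
move=> e0.
have : near_covering `[0 : R, 1] by apply/compact_near_coveringP/segment_compact.
move=> /(_ R 0^'+ (fun (d t : R) => forall x y, \val x = t ->
  `|\val y - \val x| < d -> `|u y - u x| < e)).
have cover (t : R) : `[0, 1]%classic t -> \forall t' \near t & d \near 0^'+,
    forall x y, \val x = t' -> `|\val y - \val x| < d -> `|u y - u x| < e.
  move=> t01; pose x0 : I01 R := SigSub (mem_set t01).
  have [d d0 ud] := C01_continuous_at u x0 (divr_gt0 e0 (ltr0n _ 2)).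
  exists (ball t (d / 2), [set z | z < d / 2]).
    split=> /=; first by apply: nbhsx_ballx; rewrite divr_gt0.
    by apply: nbhs_right_lt; rewrite divr_gt0.
  move=> [t' d'] [tt' d'd] x y xt' yx.
  have := ud x; have := ud y; have -> : \val x0 = t by [].
  rewrite {}xt' in yx *; move=> uy ux.
  have {}tt' : `|t - t'| < d / 2 by [].
  have {}d'd : d' < d / 2 by [].
  have {}ux : `|u x - u x0| < e / 2.
    by apply: ux; rewrite distrC; apply: (lt_trans tt'); lra.
  have {}uy : `|u y - u x0| < e / 2.
    apply: uy; rewrite -(subrKA t'); apply: (le_lt_trans (ler_normD _ _)).
    by rewrite (splitr d) ltrD ?(lt_trans yx)// distrC.
  rewrite -(subrKA (u x0)); apply: (le_lt_trans (ler_normD _ _)).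
  by rewrite (splitr e) ltrD// distrC.
move=> /(_ _ cover) H.
near (0 : R)^'+ => d; exists d => // x y yx.
have /(_ (\val x)) : `[0, 1]%classic `<=` (fun t : R => forall x y, \val x = t ->
  `|\val y - \val x| < d -> `|u y - u x| < e) by near: d.
by apply => //; rewrite /= in_itv /= C01_itv.
Unshelve. all: by end_near. Qed.

Lemma C01_equicontinuous L e : 0 < e -> exists2 d : R, 0 < d &
  forall u, u \in L -> forall x y, `|\val y - \val x| < d -> `|u y - u x| < e.
Proof.
move=> e0; elim: L => [|v L [d1 d10 dL]]; first by exists 1.
have [d2 d20 dv] := C01_unif_continuous v e0.
exists (Num.min d1 d2); first by rewrite lt_min d10.
move=> u; rewrite inE => /orP[/eqP->|uL] x y; rewrite lt_min => /andP[l1 l2].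
  exact: dv.
exact: dL.
Qed.

(** Elements of a finite-dimensional span inherit, up to a constant, any common
    modulus of continuity of the generators. *)
Lemma lin_span_oscillation L f : lin_span [set` L] f -> exists2 C : R, 0 <= C &
  forall x y e, (forall u, u \in L -> `|u y - u x| <= e) ->
    `|f y - f x| <= C * e.
Proof.
move=> [s [a [+ ->]]]; elim: s => [|v s IHs] sL.
  by exists 0 => // x y e _; rewrite big_nil subrr normr0 mul0r.
have [|C C0 hC] := IHs; first by move=> u us; apply: sL; rewrite /= inE us orbT.
exists (`|a v| + C) => [|x y e ue]; first by rewrite addr_ge0.
rewrite big_cons; set F : C01 R := \sum_(u <- s) _ in hC *.
have -> : (a v *: v + F : C01 R) y - (a v *: v + F : C01 R) x =
    a v * (v y - v x) + (F y - F x).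
  by rewrite !C01_addE !C01_scaleE opprD addrACA mulrBr.
rewrite (le_trans (ler_normD _ _))// mulrDl lerD ?hC// normrM ler_wpM2l//.
by apply/ue/sL; exact: mem_head.
Qed.

(** This weak consequence of differentiability is what the construction refutes. *)
Lemma differentiable_lipschitz_at f x : C01_differentiable_at f x ->
  exists K d : R, [/\ 0 <= K, 0 < d & forall y, `|\val y - \val x| < d ->
    `|f y - f x| <= K * `|\val y - \val x|].
Proof.
move=> [l /cvgrPdist_lt/(_ _ ltr01)].
rewrite /within /= => /nbhs_ballP[d /= d0 dl].
exists (`|l| + 1), d; split; rewrite ?addr_ge0// => y yx.
have [->|yx0] := eqVneq y x; first by rewrite !subrr normr0 mulr0.
have t0 : \val y - \val x != 0 by rewrite subr_eq0 (inj_eq val_inj).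
have := dl (\val y - \val x).
rewrite /ball /= sub0r normrN => /(_ yx t0).
rewrite subrKC in_itv /= C01_itv valKd => /(_ isT) q1.
rewrite -ler_pdivrMr ?normr_gt0// -normf_div.
rewrite -[X in `|X|](subrK l) (le_trans (ler_normD _ _))// addrC lerD2l.
by rewrite distrC ltW.
Qed.

End modulus.

(** * A sum of waves that stays wild under perturbation *)

Section construction.
Variable R : realType.
Implicit Types (u f g S : C01 R) (x y : I01 R) (e d : R) (L : seq (C01 R)).

Lemma wave_cts (N : nat) : continuous (fun x => cos (pi * (N%:R * \val x)) : R).
Proof.
have val_cts : continuous (fun x : I01 R => \val x).
  exact: (@initial_continuous _ _ set_val).
move=> x; apply: (@continuous_comp _ _ _ (fun x : I01 R => pi * (N%:R * \val x))
  cos); last exact: continuous_cos.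
exact: (@scale_cts _ _ pi (cts_scale N%:R (mkcts val_cts))).
Qed.

Definition wave (N : nat) : C01 R := mkcts (@wave_cts N).

Lemma waveE (N : nat) x : wave N x = cos (pi * (N%:R * \val x)) :> R.
Proof. by []. Qed.

(** Taking [i <= N] rather than the integer part of [(N + 1) x] keeps the node
    [(i + 1) / (N + 1)] inside the interval when [x = 1]. *)
Lemma bracket_I01 (N : nat) x : exists2 i : nat, (i <= N)%N &
  i%:R <= N.+1%:R * \val x <= i.+1%:R.
Proof.
have /andP[x0 x1] := C01_itv x.
have [->|xn1] := eqVneq (\val x) 1.
  by exists N => //; rewrite mulr1 lexx ler_nat leqnSn.
have Nx0 : 0 <= N.+1%:R * \val x by rewrite mulr_ge0.
exists (Num.truncn (N.+1%:R * \val x)).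
  have /andP[iNx _] := truncn_itv Nx0.
  rewrite -ltnS -(ltr_nat R) (le_lt_trans iNx)//.
  by rewrite gtr_pMr ?ltr0n// lt_neqAle xn1.
by have /andP[-> /ltW] := truncn_itv Nx0.
Qed.

(** At the two nodes [i / (N + 1)] and [(i + 1) / (N + 1)] surrounding [x] the
    wave takes the opposite values 1 and -1, so it differs from its value at [x]
    by at least 1 at one of them. *)
Lemma wave_oscillates (N : nat) x : exists2 y,
  `|\val y - \val x| <= N.+1%:R^-1 & 1 <= `|wave N.+1 y - wave N.+1 x|.
Proof.
have [i iN /andP[ix xi]] := bracket_I01 N x.
have N0 : 0 < N.+1%:R :> R by rewrite ltr0n.
have pt (j : nat) : (j <= N.+1)%N -> exists y, \val y = j%:R / N.+1%:R.
  move=> jN; have j01 : `[0 : R, 1]%classic (j%:R / N.+1%:R).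
    by rewrite /= in_itv /= divr_ge0//= ler_pdivrMr// mul1r ler_nat.
  by exists (SigSub (mem_set j01)).
have near y (j : nat) : \val y = j%:R / N.+1%:R ->
    `|j%:R - N.+1%:R * \val x| <= 1 -> `|\val y - \val x| <= N.+1%:R^-1.
  move=> -> jx; rewrite -(ler_pM2l N0) divff ?gt_eqF//.
  by rewrite -[X in X * _]gtr0_norm// -normrM mulrBr mulrCA divff ?gt_eqF// mulr1.
have val_wave y (j : nat) : \val y = j%:R / N.+1%:R ->
    wave N.+1 y = (-1) ^+ j :> R.
  rewrite waveE => ->.
  rewrite [X in pi * X]mulrCA divff ?gt_eqF// mulr1 mulr_natr -[_ *+ j]add0r.
  by rewrite (alternatingn (@cosDpi R)) cos0 mulr1.
have [a aE] := pt i (leqW iN); have [b bE] := pt i.+1 iN.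
have ax : `|\val a - \val x| <= N.+1%:R^-1.
  apply: (near a i) => //; rewrite ler_norml.
  by move: xi; rewrite -natr1 => xi; lra.
have bx : `|\val b - \val x| <= N.+1%:R^-1.
  by apply: (near b i.+1) => //; rewrite ler_norml -natr1 in xi *; lra.
have wab : 2 <= `|wave N.+1 a - wave N.+1 x| + `|wave N.+1 b - wave N.+1 x|.
  rewrite [X in _ + X]distrC; apply: le_trans (ler_normD _ _).
  rewrite addrA subrK (val_wave _ _ aE) (val_wave _ _ bE) exprS mulN1r opprK.
  by rewrite -mulr2n normrMn normrX normrN1 expr1n.
have [wa|wa] := leP 1 `|wave N.+1 a - wave N.+1 x|; first by exists a.
by exists b => //; lra.
Qed.

(** The ratio 1/8 makes the sum of all amplitudes after the [k]-th a small fraction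
    of the [k]-th one. *)
Definition amplitude (k : nat) : R := 8^-1 ^+ k.
Local Notation b := amplitude.

Lemma amplitude_gt0 k : 0 < b k.
Proof. by rewrite exprn_gt0. Qed.
Local Hint Resolve amplitude_gt0 : core.

Lemma amplitudeS k : b k.+1 = b k / 8.
Proof. by rewrite /b exprSr. Qed.

(** The sequences [S k x + 2 b k] decrease and [S k x - 2 b k] increase in [k], so
    the infimum of the former is within [2 b k] of [S k x] for all [k] at once;
    this uniform bound gives both the continuity of the limit and the size of
    the tail. *)
Lemma geometric_uniform_limit (S : nat -> C01 R) :
  (forall k x, `|S k.+1 x - S k x| <= b k) ->
  exists g : C01 R, forall k x, `|g x - S k x| <= 2 * b k.
Proof.
move=> Sb.
have up_anti k m x : (k <= m)%N -> S m x + 2 * b m <= S k x + 2 * b k.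
  move=> /subnK <-; elim: (m - k)%N => // n; apply: le_trans.
  have := Sb (n + k)%N x; rewrite addSn amplitudeS ler_norml => /andP[_ h].
  by have := amplitude_gt0 (n + k); lra.
have lo_mono k m x : (k <= m)%N -> S k x - 2 * b k <= S m x - 2 * b m.
  move=> /subnK <-; elim: (m - k)%N => // n /le_trans; apply.
  have := Sb (n + k)%N x; rewrite addSn amplitudeS ler_norml => /andP[h _].
  by have := amplitude_gt0 (n + k); lra.
have lo_up k m x : S k x - 2 * b k <= S m x + 2 * b m.
  apply: le_trans (up_anti _ _ x (leq_maxr k m)).
  apply: (le_trans (lo_mono _ _ x (leq_maxl k m))).
  by have := amplitude_gt0 (maxn k m); lra.
pose h x := inf (range (fun k => S k x + 2 * b k)).
have hS k x : `|h x - S k x| <= 2 * b k.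
  rewrite ler_norml; apply/andP; split.
    rewrite lerBrDl; apply: lb_le_inf; first by exists (S 0 x + 2 * b 0), 0%N.
    by move=> _ [m _ <-]; exact: lo_up.
  rewrite lerBlDl; apply: ge_inf; last by exists k.
  by exists (S 0 x - 2 * b 0) => _ [m _ <-]; exact: lo_up.
have h_cts : continuous h.
  apply: eps_delta_continuous => x e e0.
  have [k kb] : exists k, b k < e / 8.
    have : (fun k => b k) @ \oo --> 0 by apply: cvg_expr; rewrite ger0_norm//; lra.
    move=> /cvgrPdist_lt/(_ (e / 8)) []; first by lra.
    move=> k _ /(_ k (leqnn k)); rewrite /= sub0r normrN gtr0_norm// => kb.
    by exists k.
  have [d d0 Sd] := C01_continuous_at (S k) x (divr_gt0 e0 (ltr0n _ 2)).
  exists d => // y /Sd; have := hS k y; have := hS k x.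
  rewrite !ler_norml !ltr_norml => /andP[? ?] /andP[? ?] /andP[? ?].
  by apply/andP; split; lra.
by pose g : continuousType (I01 R) R := mkcts h_cts; exists g.
Qed.

(** By uniform continuity a large enough frequency makes all the functions chosen
    so far nearly constant at the scale of one half-period of the wave. *)
Lemma scale_choice L S (e e' : R) : 0 < e -> 0 < e' -> exists N : nat,
  N.+1%:R^-1 <= e /\
  forall x y, `|\val y - \val x| <= N.+1%:R^-1 ->
    (forall u, u \in L -> `|u y - u x| <= e) /\ `|S y - S x| <= e'.
Proof.
move=> e0 e'0.
have [d1 d10 Ld] := C01_equicontinuous L e0.
have [d2 d20 Sd] := C01_unif_continuous S e'0.
pose d := Num.min e (Num.min d1 d2).
have d0 : 0 < d by rewrite !lt_min e0 d10.
exists (Num.truncn d^-1).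
have Nd : (Num.truncn d^-1).+1%:R^-1 < d.
  by rewrite invf_plt ?posrE ?ltr0n// truncnS_gt.
move: Nd; rewrite !lt_min => /and3P[Ne N1 N2]; split; first exact: ltW.
move=> x y yx; split; last by apply/ltW/Sd/(le_lt_trans yx).
by move=> u uL; apply/ltW/Ld => //; exact: (le_lt_trans yx).
Qed.

(** At scale [k] the wave changes by at least [b k] between [x] and some nearby [y].
    The partial sum [S k] contributes at most [b k / 8], the tail at most
    [4 b (k + 1) = b k / 2], and [f] at most [C b k / (k + 1) <= b k / 8]; so
    [g + f] changes by at least [b k / 4] over a distance of at most
    [b k / (k + 1)], a difference quotient of order [k]. *)
Lemma wild_direction L : exists g : C01 R,
  forall f, lin_span [set` L] f -> ND01 R (g + f).
Proof.
have e0 k : 0 < b k / k.+1%:R by rewrite divr_gt0.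
have e'0 k : 0 < b k / 8 by rewrite divr_gt0.
have [N NP] := choice (fun kS : nat * C01 R =>
  scale_choice L kS.2 (e0 kS.1) (e'0 kS.1)).
pose S := fix S k : C01 R :=
  if k is j.+1 then S j + b j *: wave (N (j, S j)).+1 else 0.
have SS k x : S k.+1 x - S k x = b k * wave (N (k, S k)).+1 x.
  by rewrite [S k.+1]/= C01_addE C01_scaleE addrAC subrr add0r.
have [k x|g gS] := @geometric_uniform_limit S.
  have bk := amplitude_gt0 k.
  rewrite SS normrM (gtr0_norm bk) ler_piMr ?(ltW bk)//.
  by rewrite waveE ler_norml cos_geN1 cos_le1.
exists g => f /lin_span_oscillation[C C0 fC] x.
move=> /differentiable_lipschitz_at[K [d [K0 d0 gfK]]].
(* One bound on [k] for three needs: [C / (k + 1) <= 1 / 8],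
   [K / (k + 1) < 1 / 4], and a scale below [d]. *)
pose k := Num.truncn (8 * C + 4 * K + d^-1).
have kP : 8 * C + 4 * K + d^-1 < k.+1%:R by exact: truncnS_gt.
have k0 : 0 < k.+1%:R :> R by rewrite ltr0n.
have di0 : 0 < d^-1 by rewrite invr_gt0.
have [NE Nosc] := NP (k, S k); rewrite /= in NE Nosc.
set M := N (k, S k) in NE Nosc.
have [y yx wy] := wave_oscillates M x.
have [Lyx Syx] := Nosc x y yx.
have fyx := fC _ _ _ Lyx.
have b0 := amplitude_gt0 k.
have b1 : b k <= 1 by apply: exprn_ile1; lra.
have yxd : `|\val y - \val x| < d.
  apply: (le_lt_trans (le_trans yx NE)); rewrite ltr_pdivrMr//.
  apply: (le_lt_trans b1); rewrite -ltr_pdivrMl// mulr1.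
  by lra.
have := gfK y yxd; rewrite !C01_addE => gf.
have Ke : K * `|\val y - \val x| < b k / 4.
  apply: (le_lt_trans (ler_wpM2l K0 (le_trans yx NE))).
  by rewrite mulrCA ltr_pM2l// ltr_pdivrMr//; lra.
have Ce : C * (b k / k.+1%:R) <= b k / 8.
  by rewrite mulrCA ler_wpM2l ?(ltW b0)// ler_pdivrMr//; lra.
have wb : b k <= `|b k * (wave M.+1 y - wave M.+1 x)|.
  by rewrite normrM (gtr0_norm b0) ler_peMr// ltW.
have gy := gS k.+1 y; have gx := gS k.+1 x.
rewrite amplitudeS in gy gx.
have Ey := SS k y; have Ex := SS k x; rewrite -/M in Ey Ex.
rewrite mulrBr in wb.
have {}gf := le_lt_trans gf Ke; have {}fyx := le_trans fyx Ce.
move: gf fyx gy gx Syx; rewrite ltr_norml !ler_norml.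
move=> /andP[? ?] /andP[? ?] /andP[? ?] /andP[? ?] /andP[? ?].
by move: wb; rewrite ler_normr => /orP[?|?]; lra.
Qed.

End construction.

(** * The nowhere differentiable functions *)

Section nowhere_differentiable.
Variable R : realType.
Implicit Types (f : C01 R) (x : I01 R).

Lemma ND01_not0 : ~ ND01 R 0.
Proof.
have x01 : `[0 : R, 1]%classic 0 by rewrite /= in_itv /= lexx ler01.
move=> /(_ (SigSub (mem_set x01))); apply; exists 0.
under eq_fun do rewrite subrr mul0r.
exact: cvg_cst.
Qed.

Lemma C01_differentiableZ (c : R) f x :
  C01_differentiable_at f x -> C01_differentiable_at (c *: f : C01 R) x.
Proof.
move=> [l fl]; exists (c * l).
under eq_fun do rewrite !C01_scaleE -mulrBr -mulrA.
by apply: cvgM => //; exact: cvg_cst.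
Qed.

Lemma ND01Z (c : R) f : c != 0 -> ND01 R f -> ND01 R (c *: f).
Proof.
move=> c0 fND x /(@C01_differentiableZ c^-1); rewrite scalerA mulVf// scale1r.
exact: fND.
Qed.

End nowhere_differentiable.

Theorem theorem1p1 (R : realType) (n : nat) (hn : (0 < n)%N) :
  pair_lineable `I_n [set: nat] (ND01 R).
Proof.
exact: (pair_lineable_of_extension (@ND01_not0 R) (@ND01Z R)
  (@wild_direction R)).
Qed.
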